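(* Let $\gamma$ be a POS, $\mu$ an extremal point of $\mathcal G(\gamma)$ and $(\Lambda_n)_{n\in\mathbb N}$ an increasing sequence of time boxes with $\bigcup_n\Lambda_n=S$. Then: (i) for every bounded local function $h$ on $\Omega$, $\gamma_{\Lambda_n}(h\mid\omega)\to\mu(h)$ for $\mu$-almost every $\omega$; (ii) if moreover $E$ is a compact metric space (with its Borel $\sigma$-algebra, $\Omega$ carrying the product topology), then there is a set of full $\mu$-measure of configurations $\omega$ such that $\gamma_{\Lambda_n}(h\mid\omega)\to\mu(h)$ as $n\to\infty$ simultaneously for all continuous local functions $h$ on $\Omega$.
   Context: $(S,\le)$ is a countable partially ordered set. For $x\in S$ write $x_-=\{y\in S:y<x\}$, $x_+=\{y\in S:y>x\}$. For $\Upsilon\subset S$: $\max(\Upsilon)=\{x\in\Upsilon: y\notin\Upsilon\text{ for all }y>x\}$, $\min(\Upsilon)=\{x\in\Upsilon: y\notin\Upsilon\text{ for all }y<x\}$, the past $\Upsilon_-=\{x\in S\setminus\Upsilon:\exists y\in\Upsilon,\ x<y\}$, the future $\Upsilon_+=\{x\in S\setminus\Upsilon:\exists y\in\Upsilon,\ x>y\}$, and the outer time $\Upsilon^*=\{x\in S: x\text{ is comparable with no }y\in\Upsilon\}$. Standing assumptions: for every $x\in S$, $\max(x_-)$ and $\min(x_+)$ are finite, every $y<x$ satisfies $y\le y_0<x$ for some $y_0\in\max(x_-)$, every $z>x$ satisfies $z\ge z_0>x$ for some $z_0\in\min(x_+)$; and $S$ has no minimal element. A finite set $\Lambda\subset S$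 is a time box if $\Lambda_-\cap\Lambda_+=\emptyset$; $\mathcal T_b$ denotes the set of time boxes. $(E,\mathcal E)$ is a measurable space, $\Omega=E^S$ with the product $\sigma$-algebra $\mathcal F$; $\mathcal F_\Upsilon$ is the $\sigma$-algebra generated by the coordinates in $\Upsilon$; a function is local if it is $\mathcal F_\Delta$-measurable for some finite $\Delta\subset S$. A proper oriented kernel on $\Lambda\in\mathcal T_b$ is a map $\gamma_\Lambda:\mathcal F_{S\setminus\Lambda_+}\times\Omega\to[0,1]$ such that (a) $\gamma_\Lambda(\cdot,\omega)$ is a probability measure for each $\omega$; (b) $\gamma_\Lambda(A,\cdot)$ is $\mathcal F_{\Lambda_-\cup\Lambda^*}$-measurable for each $A\in\mathcal F_{S\setminus\Lambda_+}$; (c) $\gamma_\Lambda(A,\cdot)$ is $\mathcal F_{\Lambda_-}$-measurable for each $A\in\mathcal F_\Lambda$; (d) $\gamma_\Lambda(B,\omega)=\mathbf 1_B(\omega)$ for all $B\in\mathcal F_{\Lambda_-\cup\Lambda^*}$. Write $\gamma_\Lambda(f\mid\omega)=\int f\,d\gamma_\Lambda(\cdot,\omega)$; compositions: $(\gamma_\Delta\gamma_\Lambda)(f\mid\omega)=\int\gamma_\Lambda(f\mid\sigma)\,\gamma_\Delta(d\sigma,\omega)$, $(\mu\gamma_\Lambda)(f)=\int\gamma_\Lambda(f\mid\sigma)\,\mu(d\sigma)$. A POS is a family $\gamma=(\gamma_\Lambda)_{\Lambda\in\mathcal T_b}$ of proper oriented kernels with $\gamma_\Delta\gamma_\Lambda=\gamma_\Delta$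 on $\mathcal F_{S\setminus\Lambda_+}$ whenever $\Lambda\subset\Delta$ are time boxes. $\mathcal G(\gamma)$ is the (convex) set of probability measures $\mu$ with $\mu\gamma_\Lambda=\mu$ on $\mathcal F_{S\setminus\Lambda_+}$ for all $\Lambda\in\mathcal T_b$. *)

(* Defs.v *)
From HB Require Import structures.
From mathcomp Require Import all_boot all_order all_algebra.
From mathcomp Require Import all_classical all_reals all_analysis measurable_realfun.
Set Implicit Arguments. Unset Strict Implicit. Unset Printing Implicit Defensive.
Import Order.TTheory GRing.Theory Num.Theory.
Local Open Scope classical_set_scope.
Local Open Scope ring_scope.

Section Poset.
Variables (S : Type) (le : S -> S -> Prop).

Definition lt (x y : S) : Prop := le x y /\ x <> y.

Definition is_partial_order : Prop :=
  (forall x, le x x) /\ (forall x y, le x y -> le y x -> x = y) /\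
  (forall x y z, le x y -> le y z -> le x z).

Definition pt_past (x : S) : set S := [set y | lt y x].
Definition pt_future (x : S) : set S := [set y | lt x y].

Definition setmax (U : set S) : set S :=
  [set x | U x /\ forall y, lt x y -> ~ U y].
Definition setmin (U : set S) : set S :=
  [set x | U x /\ forall y, lt y x -> ~ U y].

Definition past (U : set S) : set S :=
  [set x | ~ U x /\ exists2 y, U y & lt x y].
Definition future (U : set S) : set S :=
  [set x | ~ U x /\ exists2 y, U y & lt y x].
Definition comparable (x y : S) : Prop := le x y \/ le y x.
Definition outer (U : set S) : set S :=
  [set x | forall y, U y -> ~ comparable x y].

Definition standing_assumptions : Prop :=
  countable [set: S] /\
  [/\ is_partial_order,
   (forall x, finite_set (setmax (pt_past x)) /\ finite_set (setmin (pt_future x))),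
   (forall x y, lt y x -> exists y0, [/\ setmax (pt_past x) y0, le y y0 & lt y0 x]),
   (forall x z, lt x z -> exists z0, [/\ setmin (pt_future x) z0, le z0 z & lt x z0])
   & (forall x, exists y, lt y x) (* no minimal element *)].

Definition time_box (L : set S) : Prop :=
  finite_set L /\ past L `&` future L = set0.

End Poset.

Section Config.
Variables (S : Type) (d : measure_display) (E : measurableType d).

Definition coord_gen (U : set S) : set (set (S -> E)) :=
  [set A | exists x, U x /\ exists2 B : set E, measurable B &
                                         A = (fun w : S -> E => w x) @^-1` B].

Definition OmU (U : set S) :=
  g_sigma_algebraType (coord_gen U).

Definition Om := OmU setT.

Definition local_fun (R : realType) (h : (S -> E) -> R) : Prop :=
  exists Delta : set S, finite_set Delta /\
    measurable_fun setT (h : OmU Delta -> R).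

Definition bounded_fun_ (R : realType) (h : (S -> E) -> R) : Prop :=
  exists M : R, forall w, `|h w| <= M.

End Config.

Local Open Scope ereal_scope.

Section Kernels.
Variables (S : Type) (le : S -> S -> Prop)
  (d : measure_display) (E : measurableType d) (R : realType).

Definition kernel_family :=
  forall L : set S, (S -> E) -> probability (OmU E (~` future le L)) R.

Definition proper_oriented_kernel (g : kernel_family) (L : set S) : Prop :=
  (forall A : set (OmU E (~` future le L)), measurable A ->
     measurable_fun setT
       (fun w : OmU E (past le L `|` outer le L) => g L w A)) /\
  (forall A : set (OmU E L), measurable A ->
     measurable_fun setT (fun w : OmU E (past le L) => g L w A)) /\
  (forall B : set (OmU E (past le L `|` outer le L)), measurable B ->
     forall w, g L w B = (\1_B w)%:E).

Definition is_POS (g : kernel_family) : Prop :=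
  (forall L, time_box le L -> proper_oriented_kernel g L) /\
  (forall L D, time_box le L -> time_box le D -> L `<=` D ->
     forall A : set (S -> E),
       measurable (A : set (OmU E (~` future le L))) ->
       measurable (A : set (OmU E (~` future le D))) ->
       forall w, \int[g D w]_s g L s A = g D w A).

Definition in_G (g : kernel_family) (mu : probability (Om S E) R) : Prop :=
  forall L, time_box le L ->
    forall A : set (OmU E (~` future le L)), measurable A ->
      \int[mu]_s g L s A = mu A.

Definition extremal_G (g : kernel_family) (mu : probability (Om S E) R) : Prop :=
  in_G g mu /\
  forall mu1 mu2 : probability (Om S E) R, in_G g mu1 -> in_G g mu2 ->
    forall t : R, (0 < t < 1)%R ->
      (forall A : set (Om S E), measurable A ->
         mu A = t%:E * mu1 A + (1 - t)%:E * mu2 A) ->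
      forall A : set (Om S E), measurable A -> mu1 A = mu2 A.

End Kernels.

Definition exhausting_time_boxes (S : Type) (le : S -> S -> Prop)
  (L : nat -> set S) : Prop :=
  [/\ forall n, time_box le (L n), forall n, L n `<=` L n.+1
    & \bigcup_n L n = setT].

Definition borelType (E : ptopologicalType) :=
  g_sigma_algebraType (@open E).

(* Main.v *)
Require Import Defs.
From HB Require Import structures.
From mathcomp Require Import all_boot all_order all_algebra.
From mathcomp Require Import all_classical all_reals all_analysis measurable_realfun.
From mathcomp Require Import lra.
Import Order.TTheory GRing.Theory Num.Theory.
Import numFieldNormedType.Exports.
Local Open Scope classical_set_scope.
Local Open Scope ring_scope.
Set Implicit Arguments.
Unset Strict Implicit.
Unset Printing Implicit Defensive.

(** Write [B_L] for the sites that are neither in the time box [L] nor in its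
    future, i.e. [past L `|` outer L].  For an exhausting sequence the sets
    [B_(Lam n)] decrease, and for a local event [A] the variables
    [gamma (Lam n) w A] form a reversed martingale under [mu]: they are the
    conditional probabilities of [A] given the coordinates in [B_(Lam n)].  An
    event measurable with respect to every [B_L] has measure 0 or 1, since
    otherwise conditioning [mu] on it and on its complement would split the
    extremal measure [mu].

    If [mu A < c], the tail event "[gamma (Lam n) w A > c] infinitely often"
    therefore has measure 0 or 1.  Splitting the union of the events
    [gamma (Lam n) w A > c], [N <= n < N + k], according to the largest such [n]
    gives [c * mu U <= mu (A `&` U)] for the union [U]; measure 1 would force
    [c <= mu A].  Applying this to [A] and to its complement proves convergence
    for local events.

    Both parts then follow from uniform approximation of [h] by functions taking
    finitely many values on local cells.  In (i) the cells are level sets of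
    [h].  In (ii) they come from finite partitions of the compact space [E] into
    small Borel pieces: countably many cells serve all continuous local [h]
    simultaneously, by uniform continuity on the compact product. *)

(** * Order geometry of time boxes *)

Section TimeBoxes.
Context {S : Type} (le : S -> S -> Prop).
Hypothesis le_refl : forall x, le x x.

(** For past sites this is the time box condition; an outer site is comparable with no site of the
    box, unlike a future site. Events on [B_L] are therefore in the domain of the kernel on [L]. *)
Lemma time_box_boundary_notfuture (L : set S) : time_box le L ->
  past le L `|` outer le L `<=` ~` future le L.
Proof.
move=> [_ pf0] x [px|ox] fx; first by rewrite -[False]/(set0 x) -pf0.
by case: fx => _ [y Ly [yx _]]; apply: (ox _ Ly); right.
Qed.

(** If [x] is comparable with some [y] in [L], then [y] below [x] would put [x] in the future of
    [D], so [x] is below [y]. This makes the sigma-algebras on [B_L] decrease as the box grows. *)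
Lemma time_box_boundaryS (L D : set S) : time_box le D -> L `<=` D ->
  past le D `|` outer le D `<=` past le L `|` outer le L.
Proof.
move=> tD LD x xD.
have nDx : ~ D x by case: xD => [[]//|oD] Dx; apply: (oD x Dx); left.
have nLx : ~ L x by move=> /LD.
have nf : ~ future le L x.
  move=> [_ [y Ly yx]]; apply: (time_box_boundary_notfuture tD xD).
  by split=> //; exists y => //; exact: LD.
have [[y Ly xy]|nc] := pselect (exists2 y, L y & Defs.comparable le x y); last first.
  by right=> y Ly xy; apply: nc; exists y.
have neq : x <> y by move=> xE; apply: nLx; rewrite xE.
case: xy => xy; first by left; split=> //; exists y.
by exfalso; apply: nf; split=> //; exists y => //; split=> // yx; exact: neq.
Qed.

Lemma subset_notfuture (L : set S) : L `<=` ~` future le L.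
Proof. by move=> x Lx []. Qed.

End TimeBoxes.

(** * Exhausting sequences of time boxes *)

Section Exhaustion.
Context {S : Type} {le : S -> S -> Prop} {Lam : nat -> set S}.
Hypothesis exL : exhausting_time_boxes le Lam.

Lemma exhausting_homo m n : (m <= n)%N -> Lam m `<=` Lam n.
Proof.
case: exL => _ incL _; elim: n => [|n IH]; first by rewrite leqn0 => /eqP ->.
rewrite leq_eqVlt => /predU1P[->//|]; rewrite ltnS => /IH mn.
exact: subset_trans (incL n).
Qed.

Lemma exhausting_finite_subset (D : set S) : finite_set D ->
  exists n, D `<=` Lam n.
Proof.
case: exL => _ _ LT; move=> /(@finite_seqP {classic S})[s ->].
elim: s => [|x s [n sn]]; first by exists 0%N.
have [m _ xm] : (\bigcup_n Lam n) x by rewrite LT.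
exists (maxn m n) => y /=; rewrite in_cons => /predU1P[->|ys].
  exact: exhausting_homo (leq_maxl m n) _ xm.
exact: exhausting_homo (leq_maxr m n) _ (sn _ ys).
Qed.

(** Dropping the first [N] boxes lets a given finite set of sites be assumed inside the initial
    box. *)
Lemma exhausting_shift N : exhausting_time_boxes le (fun n => Lam (n + N)).
Proof.
case: (exL) => tL incL LT; split=> //.
rewrite -subTset -LT => x [n _ nx]; exists n => //.
exact: exhausting_homo (leq_addr N n) _ nx.
Qed.

End Exhaustion.

Lemma measurable_OmUS {S : Type} {d : measure_display} {E : measurableType d}
    (U V : set S) (A : set (S -> E)) : U `<=` V ->
  measurable (A : set (OmU E U)) -> measurable (A : set (OmU E V)).
Proof.
move=> UV; apply: sub_sigma_algebra2 => B [x [Ux [C mC ->]]].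
by exists x; split; [exact: UV|exists C].
Qed.

(** * Reversed martingales with a trivial tail *)

Section ReverseMartingale.
Context {d : measure_display} {T : measurableType d} {R : realType}.
Variables (mu : probability T R) (G : nat -> set (set T)).
Local Notation F n := (<<s G n >>).

Hypothesis F_measurable : forall n, F n `<=` measurable.
Hypothesis F_decr : forall n, F n.+1 `<=` F n.
Hypothesis F_trivial : forall B, (forall n, F n B) -> mu B = 0%E \/ mu B = 1%E.

Variables (A : set T) (X : nat -> T -> \bar R) (c : R).
Hypothesis mA : measurable A.
Hypothesis X_ge0 : forall n x, (0 <= X n x)%E.
Hypothesis X_meas : forall n, measurable_fun setT (X n).
Hypothesis X_adapted : forall n, F n [set x | c%:E < X n x]%E.
Hypothesis X_cond : forall n B, F n B ->
  (\int[mu]_(x in B) X n x)%E = mu (A `&` B).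

Let D n := [set x | c%:E < X n x]%E.

(** The window of indices is finite so that a last exceedance exists and induction on [k]
    applies. *)
Definition exceed (N k : nat) : set T :=
  [set x | exists2 i, (N <= i < N + k)%N & D i x].

Let exceed0 N : exceed N 0 = set0.
Proof. by apply/seteqP; split=> // x [i]; rewrite addn0; case: ltngtP. Qed.

Let exceedS N k :
  exceed N k.+1 = exceed N.+1 k `|` (D N `\` exceed N.+1 k).
Proof.
apply/seteqP; split=> x.
  move=> [i /andP[Ni ik] Dix].
  have [|nx] := pselect (exceed N.+1 k x); first by left.
  right; split=> //; move: Ni; rewrite leq_eqVlt => /predU1P[->//|Ni].
  by exfalso; apply: nx; exists i => //; rewrite Ni addSnnS.
move=> [[i /andP[Ni ik] Dix]|[Dx _]].
  by exists i => //; rewrite (ltnW Ni) -addSnnS.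
by exists N => //; rewrite leqnn addnS ltnS leq_addr.
Qed.

Let FU n (B C : set T) : F n B -> F n C -> F n (B `|` C).
Proof. exact: (@measurableU _ (g_sigma_algebraType (G n))). Qed.

Let FD n (B C : set T) : F n B -> F n C -> F n (B `\` C).
Proof. exact: (@measurableD _ (g_sigma_algebraType (G n))). Qed.

Let F_homo m n : (m <= n)%N -> F n `<=` F m.
Proof.
elim: n => [|n IH]; first by rewrite leqn0 => /eqP ->.
rewrite leq_eqVlt => /predU1P[->//|]; rewrite ltnS => /IH mn.
by move=> B FB; exact: (mn B (F_decr FB)).
Qed.

Lemma exceed_adapted N k : F N (exceed N k).
Proof.
elim: k N => [|k IH] N.
  by rewrite exceed0; exact: (@measurable0 _ (g_sigma_algebraType (G N))).
rewrite exceedS.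
have H : F N (exceed N.+1 k) by exact: F_decr (IH _).
exact: (FU H (FD (@X_adapted N) H)).
Qed.

(* [D N `\` exceed N.+1 k] is the event that [N] is the last index at which
   [X] exceeds [c]; it lies in [F N] because [F] decreases. *)
Lemma exceed_le N k : (0 <= c)%R ->
  (c%:E * mu (exceed N k) <= mu (A `&` exceed N k))%E.
Proof.
move=> c0; elim: k N => [|k IH] N.
  by rewrite exceed0 setI0 measure0 mule0.
rewrite exceedS.
have mE : measurable (exceed N.+1 k).
  exact: F_measurable (exceed_adapted _ _).
have FB : F N (D N `\` exceed N.+1 k).
  exact: (FD (@X_adapted N) (F_decr (exceed_adapted _ _))).
have mB := F_measurable FB.
rewrite setIUr measureU ?setDIK// measureU; last 3 first.
- exact: measurableI.
- exact: measurableI.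
- by rewrite setIACA setDIK setI0.
rewrite ge0_muleDr//; apply: leeD; first exact: IH.
(* On [D N] the integrand exceeds [c], and [X_cond] evaluates its integral because the piece belongs
   to [F N]. *)
rewrite /= -(X_cond FB) -integral_cst//; apply: ge0_le_integral => //.
  exact: measurable_funTS.
by move=> x [Dx _]; exact: ltW.
Qed.

(** A limsup ignores finitely many terms, so it can be written with indices at least [n], whose
    events all lie in [F n]. *)
Let limsup_adapted n : F n (lim_sup_set D).
Proof.
have -> : lim_sup_set D =
    \bigcap_i \bigcup_j D (i + j + n).
  apply/seteqP; split=> x Dx i _.
    have [j /= ij Djx] := Dx (i + n)%N I; exists (j - (i + n))%N => //.
    by rewrite addnAC subnKC.
  have [j _ Djx] := Dx i I; exists (i + j + n)%N => //=.
  by rewrite -addnA leq_addr.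
apply: (@bigcapT_measurable _ (g_sigma_algebraType (G n))) => i.
apply: bigcupT_measurable => j.
exact: (F_homo (leq_addl (i + j) n) (@X_adapted _)).
Qed.

Lemma reverse_martingale_eventually_le : (mu A < c%:E)%E ->
  {ae mu, forall x, \forall n \near \oo, (X n x <= c%:E)%E}.
Proof.
move=> Ac.
have c0 : (0 <= c)%R by rewrite -lee_fin (le_trans _ (ltW Ac)).
exists (lim_sup_set D); split.
- exact: F_measurable (@limsup_adapted 0).
- have [//|D1] := F_trivial (@limsup_adapted); exfalso.
  have mE k : measurable (exceed 0 k) by exact: F_measurable (exceed_adapted _ _).
  have mUE : measurable (\bigcup_k exceed 0 k) by exact: bigcupT_measurable.
  (* The limsup lies in this union, which then has measure 1 too; letting [k] grow in [exceed_le]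
     yields [c <= mu A], a contradiction. *)
  have UE1 : mu (\bigcup_k exceed 0 k) = 1%E.
    apply/eqP; rewrite eq_le probability_le1//= -D1 le_measure ?inE//.
      exact: F_measurable (@limsup_adapted 0).
    move=> x /(_ 0%N I)[i _ Dix]; exists i.+1 => //.
    by exists i => //=; rewrite add0n ltnSn.
  have : (c%:E * mu (exceed 0 k))%E @[k --> \oo] --> (c%:E * 1)%E.
    apply: cvgeZl => //; rewrite -UE1; apply: nondecreasing_cvg_mu => //.
    move=> k l kl; apply/subsetPset => x [i /= ik Dix]; exists i => //=.
    by rewrite add0n; exact: leq_trans kl.
  rewrite mule1 => cE.
  move: Ac; apply/negP; rewrite -leNgt -(cvg_lim _ cE)//.
  apply: lime_le; first exact: cvgP cE.
  apply: nearW => k; apply: le_trans (exceed_le _ _ c0) _.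
  by rewrite le_measure ?inE//; exact: measurableI.
- move=> x /= nX N _; apply: contrapT => nD; apply: nX.
  exists N => // n Nn; rewrite leNgt; apply/negP => cX.
  by apply: nD; exists n.
Qed.

End ReverseMartingale.

Lemma measurable_fun_OmUS {S : Type} {d d' : measure_display}
    {E : measurableType d} {Y : measurableType d'} (U V : set S)
    (f : (S -> E) -> Y) : U `<=` V ->
  measurable_fun setT (f : OmU E U -> Y) ->
  measurable_fun setT (f : OmU E V -> Y).
Proof.
by move=> UV mf _ B mB; exact: (measurable_OmUS UV (mf measurableT B mB)).
Qed.

(** * Conditioning a probability measure on an event *)

Section Conditioning.
Context {d : measure_display} {T : measurableType d} {R : realType}.
Variable (mu : probability T R).
Local Open Scope ereal_scope.

Lemma ge0_integral_mrestr (B : set T) (mB : measurable B) (f : T -> \bar R) :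
  measurable_fun setT f -> (forall x, 0 <= f x) ->
  \int[mrestr mu mB]_x f x = \int[mu]_(x in B) f x.
Proof.
move=> mf f0.
rewrite (@ge0_negligible_integral _ _ _ _ setT (~` B))//; last 2 first.
- exact: measurableC.
- by rewrite /= /mrestr setICl measure0.
rewrite setDE setCK setTI; apply: eq_measure_integral => C mC CB.
by rewrite /= /mrestr setIidl.
Qed.

(** The second argument of [mnormalize] is the value taken when [mu B = 0], so that this is a
    probability measure for every [B]. *)
Definition condition (B : set T) (mB : measurable B) : probability T R :=
  mnormalize (mrestr mu mB) mu.

Lemma conditionE (B : set T) (mB : measurable B) : mu B != 0 ->
  forall C, condition mB C = mu (C `&` B) * ((fine (mu B))^-1)%:E.
Proof.
move=> B0 C; rewrite /condition /= /mnormalize /= /mrestr setTI (negbTE B0) /=.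
case: eqP => // Boo.
by have : mu B \is a fin_num by [exact: fin_num_measure]; rewrite Boo.
Qed.

Lemma ge0_integral_condition (B : set T) (mB : measurable B) (f : T -> \bar R) :
  mu B != 0 -> measurable_fun setT f -> (forall x, 0 <= f x) ->
  \int[condition mB]_x f x =
    (\int[mu]_(x in B) f x) * ((fine (mu B))^-1)%:E.
Proof.
move=> B0 mf f0.
have k0 : (0 <= (fine (mu B))^-1)%R by rewrite invr_ge0 fine_ge0.
rewrite (eq_measure_integral (mscale (NngNum k0) (mrestr mu mB))); last first.
  by move=> C mC _; apply: (etrans (conditionE mB B0 C)); rewrite muleC.
by rewrite ge0_integral_mscale// ge0_integral_mrestr// muleC.
Qed.

End Conditioning.

(** * Oriented kernels, tail triviality and convergence for local events *)

Section OrientedKernels.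
Context {R : realType} {S : Type} {le : S -> S -> Prop}
  {d : measure_display} {E : measurableType d}.
Hypothesis le_refl : forall x, le x x.
Local Open Scope ereal_scope.
Local Notation bd L := (past le L `|` outer le L).

Variable gamma : kernel_family le E R.
Hypothesis proper : forall L, time_box le L -> proper_oriented_kernel gamma L.

(** By properness [B] has kernel mass 0 or 1 according to [w]; intersecting with a null event leaves
    nothing, and with an event of mass 1 changes nothing. *)
Lemma kernel_setI (L : set S) (A B : set (S -> E)) w : time_box le L ->
  measurable (A : set (OmU E (~` future le L))) ->
  measurable (B : set (OmU E (bd L))) ->
  gamma L w (A `&` B) = (\1_B w)%:E * gamma L w A.
Proof.
move=> tL mA mB; have [_ [_ /(_ _ mB w) gB]] := proper tL.
have mB' : measurable (B : set (OmU E (~` future le L))).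
  exact: (measurable_OmUS (time_box_boundary_notfuture tL) mB).
have le0 (C D : set (OmU E (~` future le L))) : measurable C -> measurable D ->
    gamma L w D = 0 -> gamma L w (C `&` D) = 0.
  move=> mC mD D0; apply/eqP; rewrite eq_le measure_ge0 andbT -D0.
  by apply: le_measure; rewrite ?inE//; exact: measurableI.
move: gB; rewrite indicE; case: (w \in B) => /= gB.
  rewrite mul1e -[in RHS](setIT A) -(setUCr B) setIUr measureU//.
  - rewrite /= (le0 A (~` B))// ?addr0 ?adde0//; first exact: measurableC.
    by rewrite probability_setC// gB subee.
  - exact: measurableI.
  - by apply: measurableI => //; exact: measurableC.
  - by rewrite setIACA setICr setI0.
by rewrite mul0e; exact: le0.
Qed.

Lemma measurable_kernel_OmU (L : set S) (A : set (S -> E)) : time_box le L ->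
  measurable (A : set (OmU E (~` future le L))) ->
  measurable_fun setT (fun w : Om S E => gamma L w A).
Proof.
move=> tL mA; have [/(_ _ mA) mg _] := proper tL.
exact: (measurable_fun_OmUS _ mg).
Qed.

Section InvariantMeasure.
Variable mu : probability (Om S E) R.
Hypothesis Gmu : in_G gamma mu.

(** Invariance of [mu] is applied to [A] intersected with [B], and properness pulls the indicator of
    [B] out of the kernel. *)
Lemma integral_kernel_boundary (L : set S) (A B : set (S -> E)) :
  time_box le L ->
  measurable (A : set (OmU E (~` future le L))) ->
  measurable (B : set (OmU E (bd L))) ->
  \int[mu]_(x in B) gamma L x A = mu (A `&` B).
Proof.
move=> tL mA mB; rewrite -(Gmu tL); last first.
  apply: measurableI => //.
  exact: (measurable_OmUS (time_box_boundary_notfuture tL) mB).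
rewrite integral_mkcond; apply: eq_integral => x _.
rewrite kernel_setI// patchE indicE.
by case: ifP => _; rewrite ?mul1e ?mul0e.
Qed.

(** Integrating the kernel over [B] gives the mass of [A] inside [B], for every box at once;
    dividing by [mu B] is invariance of the conditioned measure. *)
Lemma in_G_condition (B : set (Om S E)) (mB : measurable B) : mu B != 0 ->
  (forall L, time_box le L -> measurable (B : set (OmU E (bd L)))) ->
  in_G gamma (condition mu mB).
Proof.
move=> B0 tailB L tL A mA.
rewrite ge0_integral_condition//; last exact: measurable_kernel_OmU.
by rewrite integral_kernel_boundary//; [rewrite conditionE|exact: tailB].
Qed.

End InvariantMeasure.

Variable mu : probability (Om S E) R.
Hypothesis extr : extremal_G gamma mu.

Lemma extremal_trivial (B : set (S -> E)) :
  (forall L, time_box le L -> measurable (B : set (OmU E (bd L)))) ->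
  measurable (B : set (Om S E)) -> mu B = 0 \/ mu B = 1.
Proof.
move=> tailB mB; have [Gmu ext] := extr.
have [->|B0] := eqVneq (mu B) 0; first by left.
have [->|B1] := eqVneq (mu B) 1; first by right.
exfalso.
have mC : measurable (~` B : set (Om S E)) by exact: measurableC.
have [p pE] : exists p, mu B = p%:E.
  by exists (fine (mu B)); rewrite fineK// fin_num_measure.
have CE : mu (~` B) = (1 - p)%:E by rewrite probability_setC// pE.
have p1 : (1 - p != 0)%R.
  by rewrite subr_eq0 eq_sym; apply: contraNN B1 => /eqP p1; rewrite pE p1.
have p0 : (p != 0)%R by apply: contraNN B0 => /eqP p0; rewrite pE p0.
have C0 : mu (~` B) != 0 by rewrite CE; apply: contraNN p1 => /eqP[->].
have G1 : in_G gamma (condition mu mB) by exact: in_G_condition.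
have G2 : in_G gamma (condition mu mC).
  by apply: in_G_condition => // L tL; exact: measurableC (tailB L tL).
have p01 : (0 < p < 1)%R.
  rewrite !lt_neqAle eq_sym p0 eq_sym -subr_eq0 p1 -!lee_fin -pE measure_ge0.
  by rewrite probability_le1.
have mix A : measurable (A : set (Om S E)) ->
    mu A = p%:E * condition mu mB A + (1 - p)%:E * condition mu mC A.
  move=> mA; rewrite !conditionE// CE pE /= ![_ * (_^-1)%:E]muleC !muleA.
  rewrite -!EFinM !divff// !mul1e -measureU; first by rewrite -setIUr setUCr setIT.
  - exact: measurableI.
  - exact: measurableI.
  - by rewrite setIACA setICr setI0.
(* The two conditioned measures would agree, yet they give [B] the masses 1 and 0. *)
have := ext _ _ G1 G2 p p01 mix B mB.
rewrite !conditionE// setIid setICr measure0 mul0e pE -EFinM divff//.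
by move=> /eqP; rewrite eqe oner_eq0.
Qed.

Lemma kernel_eventually_le (Lam : nat -> set S) (A : set (S -> E)) (D : set S)
    (c : R) : exhausting_time_boxes le Lam -> D `<=` Lam 0%N ->
  measurable (A : set (OmU E D)) -> mu A < c%:E ->
  {ae mu, forall w : Om S E, \forall n \near \oo, gamma (Lam n) w A <= c%:E}.
Proof.
move=> exL DL mA Ac; have [tL incL LT] := exL.
have mAL n : measurable (A : set (OmU E (~` future le (Lam n)))).
  apply: measurable_OmUS mA; apply: subset_trans (@subset_notfuture _ _ _).
  exact: subset_trans DL (exhausting_homo exL _).
apply: (@reverse_martingale_eventually_le _ (Om S E) R mu
  (fun n => @coord_gen S d E (bd (Lam n))) _ _ _ A
  (fun n w => gamma (Lam n) w A)) => //.
- by move=> n B mB; exact: (measurable_OmUS _ mB).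
- by move=> n B mB; exact: (measurable_OmUS (time_box_boundaryS _ _ _) mB).
- move=> B tailB; apply: extremal_trivial.
    (* Every time box is finite, hence inside some [Lam n], so measurability along the sequence
       suffices for all boxes. *)
    move=> L [finL _]; have [n Ln] := exhausting_finite_subset exL finL.
    exact: (measurable_OmUS (time_box_boundaryS _ _ Ln) (tailB n)).
  exact: (measurable_OmUS _ (tailB 0%N)).
- exact: measurable_OmUS mA.
- by move=> n; exact: measurable_kernel_OmU.
- move=> n; have [/(_ _ (mAL n)) mg _] := proper (tL n).
  rewrite -[X in <<s _ >> X]setTI.
  exact: (emeasurable_fun_o_infty measurableT mg c%:E).
- by move=> n B FB; apply: integral_kernel_boundary => //; exact: extr.1.
Qed.

Lemma kernel_cvg_local_set (Lam : nat -> set S) (A : set (S -> E)) (D : set S) :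
  exhausting_time_boxes le Lam -> finite_set D ->
  measurable (A : set (OmU E D)) ->
  {ae mu, forall w : Om S E, gamma (Lam n) w A @[n --> \oo] --> mu A}.
Proof.
move=> exL0 /(exhausting_finite_subset exL0)[N DN] mA.
have exL := exhausting_shift exL0 N.
have mAT : measurable (A : set (Om S E)) by exact: measurable_OmUS mA.
pose p := fine (mu A).
have pE : mu A = p%:E by rewrite /p fineK// fin_num_measure.
have CE : mu (~` A) = (1 - p)%:E by rewrite probability_setC// pE.
have mAC : measurable (~` A : set (OmU E D)) by exact: measurableC.
(* Countably many tolerances keep the union of the exceptional sets null. *)
pose e k : R := (k.+1%:R^-1)%R.
have up k : {ae mu, forall w : Om S E,
    \forall n \near \oo, gamma (Lam (n + N)%N) w A <= (p + e k)%:E}.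
  apply: (kernel_eventually_le exL _ mA); first by rewrite add0n.
  by rewrite pE lte_fin ltrDl invr_gt0.
have lo k : {ae mu, forall w : Om S E,
    \forall n \near \oo, gamma (Lam (n + N)%N) w (~` A) <= (1 - p + e k)%:E}.
  apply: (kernel_eventually_le exL _ mAC); first by rewrite add0n.
  by rewrite CE lte_fin ltrDl invr_gt0.
apply: filterS2 (ae_foralln up) (ae_foralln lo) => w upw low.
have mAn n : measurable (A : set (OmU E (~` future le (Lam (n + N)%N)))).
  apply: measurable_OmUS mA; apply: subset_trans (@subset_notfuture _ _ _).
  exact: subset_trans DN (exhausting_homo exL0 (leq_addl _ _)).
rewrite -(cvg_shiftn N) pE; apply/fine_cvgP; split.
  by near=> n; apply: fin_num_measure; exact: mAn.
apply/cvgrPdist_le => r r0.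
have [k kr] : exists k, (e k < r)%R.
  have := near_infty_natSinv_lt (PosNum r0); move=> [k _ kr].
  by exists k; exact: kr (leqnn k).
near=> n.
have fA : gamma (Lam (n + N)%N) w A \is a fin_num.
  by apply: fin_num_measure; exact: mAn.
have un : gamma (Lam (n + N)%N) w A <= (p + e k)%:E by near: n; exact: upw.
have : gamma (Lam (n + N)%N) w (~` A) <= (1 - p + e k)%:E by near: n; exact: low.
(* The upper bound for the complement becomes a lower bound for [A]. *)
rewrite probability_setC//; move: un; rewrite -(fineK fA) -EFinB !lee_fin /=.
set q := fine _ => un ln.
rewrite ler_norml; apply/andP; split; lra.
Unshelve. all: by end_near. Qed.

End OrientedKernels.

(** * Finite measurable cells and approximate integration *)

Section FiniteCells.
Context {d : measure_display} {T : measurableType d} {R : realType}.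

(** Each point is sent to the least index whose set contains it, which turns the cover into a
    partition. *)
Lemma measurable_first_hit (m : nat) (B : 'I_m -> set T) :
  (forall i, measurable (B i)) -> (forall x, exists i, B i x) ->
  exists code : T -> 'I_m, (forall x, B (code x) x) /\
    (forall i, measurable (code @^-1` [set i])).
Proof.
move=> mB Bcov.
have first x : exists i : 'I_m, B i x /\ forall j : 'I_m, (j < i)%N -> ~ B j x.
  have [i Bi] := Bcov x.
  case: (@arg_minnP _ i (fun j => `[< B j x >]) (fun j => val j)).
    exact/asboolP.
  move=> j /asboolP Bj jmin; exists j; split=> // k kj /asboolP /jmin.
  by rewrite leqNgt kj.
have [code codeP] := choice first.
exists code; split=> [x|i]; first exact: (codeP x).1.
have -> : code @^-1` [set i] =
    B i `&` \bigcap_(j in [set j : 'I_m | (j < i)%N]) ~` B j.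
  apply/seteqP; split=> x /=.
    by move=> <-; have [? cx] := codeP x; split=> // j; exact: cx.
  move=> [Bi ni]; have [Bc nc] := codeP x; apply: val_inj => /=.
  by case: (ltngtP (code x) i) => [/ni//|/nc//|].
apply: measurableI => //; apply: fin_bigcap_measurable => [|j _].
  exact: finite_finset.
exact: measurableC.
Qed.

Variables (nu : probability T R) (I : finType) (code : T -> I).
Hypothesis mcode : forall i, measurable (code @^-1` [set i]).

Let stepE (v : I -> R) x :
  v (code x) = \sum_i v i * \1_(code @^-1` [set i]) x.
Proof.
rewrite (bigD1 (code x))//= big1 ?addr0.
  by rewrite indicE mem_set// mulr1.
move=> i ix; rewrite indicE memNset ?mulr0//= => xi.
by rewrite xi eqxx in ix.
Qed.

(** The sum is the integral of [v \o code], and a probability measure does not enlarge a uniform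
    error. The error does not depend on [nu], so one approximation serves [mu] and all the
    kernels. *)
Lemma integral_cells_approx (v : I -> R) (h : T -> R) (e : R) :
  measurable_fun setT h -> (forall x, `|h x - v (code x)| <= e) ->
  (\int[nu]_x (h x)%:E)%E \is a fin_num /\
  `|\int[nu]_x h x - \sum_i v i * fine (nu (code @^-1` [set i]))| <= e.
Proof.
move=> mh he.
have mterm i : measurable_fun setT (fun x => v i * \1_(code @^-1` [set i]) x).
  by apply: measurable_funM => //; exact: measurable_indic.
have mstep : measurable_fun setT (v \o code).
  rewrite (_ : _ \o _ = fun x => \sum_i v i * \1_(code @^-1` [set i]) x).
    exact: measurable_sum.
  by apply/funext => x; exact: stepE.
have bint (f : T -> R) : measurable_fun setT f -> (exists M, forall x, `|f x| <= M) ->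
    nu.-integrable setT (EFin \o f).
  move=> mf [M fM]; apply: measurable_bounded_integrable => //.
    by rewrite [X in (X < _)%E]probability_setT ltry.
  exists M; split; first exact: num_real.
  by move=> y My x _; exact: le_trans (fM x) (ltW My).
pose M := \sum_i `|v i|.
have vM i : `|v i| <= M by rewrite /M (bigD1 i)//= lerDl sumr_ge0.
have iterm i : nu.-integrable setT
    (EFin \o (fun x => v i * \1_(code @^-1` [set i]) x)).
  apply: bint => //; exists M => x; rewrite normrM; apply: le_trans (vM i).
  by rewrite ler_piMr// indicE; case: (_ \in _); rewrite ?normr1 ?normr0.
have istep : nu.-integrable setT (EFin \o (v \o code)).
  by apply: bint => //; exists M => x; exact: vM.
have ih : nu.-integrable setT (EFin \o h).
  apply: bint => //; exists (e + M) => x.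
  by rewrite -(subrK (v (code x)) (h x)) (le_trans (ler_normD _ _))// lerD.
split; first exact: integrable_fin_num.
have -> : \sum_i v i * fine (nu (code @^-1` [set i])) = \int[nu]_x (v (code x)).
  rewrite /Rintegral; under [in RHS]eq_integral do rewrite stepE -sumEFin.
  rewrite integral_sum//= -sum_fine; last first.
    by move=> i _; exact: integrable_fin_num (iterm i).
  apply: eq_bigr => i _; rewrite -[RHS]/(Rintegral _ _ _) RintegralZl//.
    by rewrite /Rintegral integral_indic// setIT.
  apply: bint; first exact: measurable_indic.
  by exists 1 => x; rewrite indicE; case: (_ \in _); rewrite ?normr1 ?normr0.
rewrite -RintegralB//; apply: le_trans (le_normr_Rintegral _ _) _ => //.
  by apply: bint; [exact: measurable_funB|exists e].
apply: (@le_trans _ _ (\int[nu]_x e)).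
  apply: le_Rintegral => //.
    apply: bint; last by exists e => x; rewrite normr_id; exact: he.
    by apply: measurableT_comp => //; exact: measurable_funB.
  by apply: bint => //; exists `|e|.
by rewrite Rintegral_cst// [X in fine X]probability_setT mulr1.
Qed.

End FiniteCells.

(** * From convergence on cells to convergence of integrals; bounded local functions *)

Lemma cvg_approx {R : realType} (a : R^nat) (l : R) :
  (forall e, 0 < e -> exists b : R^nat, exists2 lb, b @ \oo --> lb &
     (\forall n \near \oo, `|a n - b n| <= e) /\ `|l - lb| <= e) ->
  a @ \oo --> l.
Proof.
move=> ab; apply/cvgrPdist_le => e e0.
have e3 : 0 < e / 3%:R by rewrite divr_gt0.
have [b [lb /cvgrPdist_le/(_ _ e3) bl [abn ll]]] := ab _ e3.
near=> n.
have h1 : `|a n - b n| <= e / 3%:R by near: n.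
have h2 : `|lb - b n| <= e / 3%:R by near: n.
rewrite (_ : l - a n = (l - lb) + (lb - b n) - (a n - b n)); last by lra.
rewrite (le_trans (ler_normB _ _))//.
rewrite (_ : e = e / 3%:R + e / 3%:R + e / 3%:R); last by lra.
by rewrite lerD// (le_trans (ler_normD _ _))// lerD.
Unshelve. all: by end_near. Qed.

(** Stated for a single [w], so that the exceptional null set can be chosen before or after [h].
    Finite sums over cells converge, and they approximate the integrals uniformly. *)
Lemma kernel_cvg_cells {R : realType} {S : Type} {le : S -> S -> Prop}
    {d : measure_display} {E : measurableType d}
    (gamma : kernel_family le E R) (mu : probability (Om S E) R)
    (Lam : nat -> set S) (w : S -> E) (h : (S -> E) -> R) :
  exhausting_time_boxes le Lam -> local_fun h ->
  (forall e : R, 0 < e -> exists (I : finType) (code : (S -> E) -> I)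
      (v : I -> R) (D : set S), [/\ finite_set D,
      forall i, measurable (code @^-1` [set i] : set (OmU E D)),
      forall x, `|h x - v (code x)| <= e &
      forall i, gamma (Lam n) w (code @^-1` [set i]) @[n --> \oo] -->
                mu (code @^-1` [set i])]) ->
  (fun n => (\int[gamma (Lam n) w]_x (h x)%:E)%E) @ \oo -->
    (\int[mu]_x (h x)%:E)%E.
Proof.
move=> exL [D0 [finD0 mh]] cells.
have [N0 DN0] := exhausting_finite_subset exL finD0.
have approx e : 0 < e -> exists (b : R^nat) (lb : R), [/\ b @ \oo --> lb,
    (\forall n \near \oo,
      (\int[gamma (Lam n) w]_x (h x)%:E)%E \is a fin_num /\
      `|\int[gamma (Lam n) w]_x h x - b n| <= e),
    (\int[mu]_x (h x)%:E)%E \is a fin_num & `|\int[mu]_x h x - lb| <= e].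
  move=> e0; have [I [code [v [D [finD mcode hv cvgcode]]]]] := cells e e0.
  have [N DN] := exhausting_finite_subset exL finD.
  exists (fun n => \sum_i v i * fine (gamma (Lam n) w (code @^-1` [set i]))).
  exists (\sum_i v i * fine (mu (code @^-1` [set i]))).
  have [] := @integral_cells_approx _ (Om S E) R mu I code _ v h e _ hv.
  - by move=> i; exact: (measurable_OmUS _ (mcode i)).
  - exact: (measurable_fun_OmUS _ mh).
  move=> fmu emu; split=> //.
    apply: cvg_big => [|i _]; first exact: add_continuous.
    apply: cvgMr; apply: fine_cvg; rewrite fineK; first exact: cvgcode.
    by apply: fin_num_measure; exact: (measurable_OmUS _ (mcode i)).
  (* From this index on, the box contains the sites of both the cells and [h], so both are
     measurable for the kernel. *)
  exists (maxn N N0) => // n /=; rewrite geq_max => /andP[Nn N0n].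
  have sub U m : U `<=` Lam m -> (m <= n)%N -> U `<=` ~` future le (Lam n).
    move=> Um mn; apply: subset_trans (@subset_notfuture _ _ _).
    exact: subset_trans Um (exhausting_homo exL mn).
  apply: (@integral_cells_approx _ (OmU E (~` future le (Lam n))) R
    (gamma (Lam n) w)) => //.
  - by move=> i; exact: (measurable_OmUS (sub _ _ DN Nn) (mcode i)).
  - exact: (measurable_fun_OmUS (sub _ _ DN0 N0n) mh).
have [b0 [l0 [_ fin fmu _]]] := approx 1 ltr01.
rewrite -(fineK fmu); apply/fine_cvgP; split; first by apply: filterS fin => ? [].
apply: cvg_approx => e e0; have [b [lb [blb ae _ me]]] := approx e e0.
by exists b, lb => //; split=> //; apply: filterS ae => ? [].
Qed.

Lemma kernel_cvg_bounded_local {R : realType} {S : Type} {le : S -> S -> Prop}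
    {d : measure_display} {E : measurableType d}
    (gamma : kernel_family le E R) (mu : probability (Om S E) R)
    (Lam : nat -> set S) (h : (S -> E) -> R) : (forall x, le x x) ->
  is_POS gamma -> extremal_G gamma mu -> exhausting_time_boxes le Lam ->
  bounded_fun_ h -> local_fun h ->
  {ae mu, forall w : Om S E,
     (fun n => (\int[gamma (Lam n) w]_x (h x)%:E)%E) @ \oo
       --> (\int[mu]_x (h x)%:E)%E}.
Proof.
move=> le_refl [proper _] extr exL [K hK] lh; have [D [finD mh]] := lh.
pose e k : R := k.+1%:R^-1.
(* The levels start at [-K] with spacing [e k]; the successor counts level 0, and the last level is
   within [e k] of [K]. *)
pose m k := (Num.truncn ((K + K) / e k)).+1.
pose v k i : R := i%:R * e k - K.
have cov k : exists code : (S -> E) -> 'I_(m k),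
    (forall x, `|h x - v k (code x)| <= e k) /\
    forall i, measurable (code @^-1` [set i] : set (OmU E D)).
  have e0 : 0 < e k by rewrite invr_gt0.
  pose B (i : 'I_(m k)) : set (OmU E D) := [set x | `|h x - v k i| <= e k].
  apply: (@measurable_first_hit _ (OmU E D) _ B).
    move=> i; rewrite /B -[X in measurable X]setTI.
    apply: (measurable_fun_le (f := fun x : OmU E D => `|h x - v k i|)) => //.
    by apply: measurableT_comp => //; exact: measurable_funB.
  move=> x; have := hK x; rewrite ler_norml => /andP[Kh hK'].
  have hp : 0 <= (h x + K) / e k by apply: divr_ge0; [lra|exact: ltW].
  have im : (Num.truncn ((h x + K) / e k) < m k)%N.
    rewrite ltnS; apply: le_truncn.
    by rewrite ler_pM2r ?invr_gt0// lerD2r.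
  exists (Ordinal im); rewrite /B /v /=.
  have /andP[] := truncn_itv hp.
  set t := Num.truncn _; rewrite ler_pdivlMr// ltr_pdivrMr// -(natr1 t).
  rewrite (mulrDl t%:R) mul1r => h1 h2.
  by rewrite ler_norml; apply/andP; split; lra.
pose code k := sval (cid (cov k)); pose codeP k := svalP (cid (cov k)).
have ae k i : {ae mu, forall w : Om S E,
    gamma (Lam n) w (code k @^-1` [set i]) @[n --> \oo] -->
    mu (code k @^-1` [set i])}.
  apply: (kernel_cvg_local_set le_refl proper extr exL finD).
  exact: (codeP k).2.
have aeall : {ae mu, forall w : Om S E, forall k i,
    gamma (Lam n) w (code k @^-1` [set i]) @[n --> \oo] -->
    mu (code k @^-1` [set i])}.
  by apply: ae_foralln => k; apply: filter_forall; exact: ae.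
apply: filterS aeall => w cw; apply: kernel_cvg_cells => // r r0.
have [k _ kr] := near_infty_natSinv_lt (PosNum r0).
exists 'I_(m k), (code k), (fun i : 'I_(m k) => v k i), D; split=> //.
- exact: (codeP k).2.
- move=> x; apply: le_trans ((codeP k).1 x) _; apply: ltW; exact: kr (leqnn k).
- exact: cw.
Qed.

(** * Compact state space and continuous local functions *)

Section CompactStateSpace.
Context {R : realType} {E : pseudoPMetricType R}.
Hypothesis cE : compact [set: E].

(** Finitely many balls of radius [e / 2] cover, and points of one cell share a centre. Interiors
    are taken to have open, hence Borel, sets. *)
Lemma compact_measurable_cells (e : R) : 0 < e ->
  exists (m : nat) (code : borelType E -> 'I_m),
    (forall i, measurable (code @^-1` [set i])) /\
    (forall x y : E, code x = code y -> ball x e y).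
Proof.
move=> e0; have e20 : 0 < e / 2 by rewrite divr_gt0.
move: cE; rewrite compact_cover => /(_ E setT (fun c => (ball c (e / 2))^°)).
case.
- by move=> c _; exact: open_interior.
- by move=> x _; exists x => //; exact: nbhsx_ballx.
move=> s _ cov.
pose c i := nth point (finmap.enum_fset s) i.
pose B (i : 'I_(size (finmap.enum_fset s))) : set (borelType E) :=
  (ball (c i) (e / 2))^°.
have [] := @measurable_first_hit _ (borelType E) _ B.
- by move=> i; apply: sub_sigma_algebra; exact: open_interior.
- move=> x; have [y /= ys yx] := cov x I.
  have iy : (index y (finmap.enum_fset s) < size (finmap.enum_fset s))%N.
    by rewrite index_mem.
  by exists (Ordinal iy); rewrite /B /c /= nth_index.
move=> code [codeB mcode]; exists (size (finmap.enum_fset s)), code; split=> //.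
move=> x y xy; rewrite [e]splitr.
apply: (@ball_triangle _ _ (c (code x))).
  by apply: ball_sym; exact: interior_subset (codeB x).
by rewrite xy; exact: interior_subset (codeB y).
Qed.

Context {S : Type} {le : S -> S -> Prop} {Lam : nat -> set S}.
Hypothesis exL : exhausting_time_boxes le Lam.

Let e k : R := k.+1%:R^-1.

(** One index controls both the sites and the radius. The boxes decrease and every site enters some
    [Lam n], so the filter they generate converges to [w] in each coordinate. *)
Lemma ptws_box_basis (w : S -> E) (U : set (S -> E)) :
  nbhs (w : {ptws S -> E}) U ->
  exists n, forall w', (forall x, Lam n x -> ball (w x) (e n) (w' x)) -> U w'.
Proof.
move=> wU.
pose box n := [set w' : S -> E | forall x, Lam n x -> ball (w x) (e n) (w' x)].
have box_homo m n : (m <= n)%N -> box n `<=` box m.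
  move=> mn w' bw' x Lx; apply: le_ball (bw' x (exhausting_homo exL mn Lx)).
  by rewrite /e lef_pV2 ?posrE// ler_nat ltnS.
have FF : Filter (filter_from setT box).
  apply: filter_from_filter; first by exists 0%N.
  move=> i j _ _; exists (maxn i j) => // w' bw'; split.
    exact: box_homo (leq_maxl i j) _ bw'.
  exact: box_homo (leq_maxr i j) _ bw'.
have Fw : filter_from setT box --> (w : {ptws S -> E}).
  apply/cvg_sup => x A /= [B [[V oV <-] /= Vw] VA].
  have /nbhs_ballP[r /= r0 rV] : nbhs (w x) V by exact: open_nbhs_nbhs.
  have [n1 _ n1r] := near_infty_natSinv_lt (PosNum r0).
  have [n2 _ n2x] : (\bigcup_n Lam n) x by case: exL => _ _ ->.
  exists (maxn n1 n2) => // w' bw'; apply: VA => /=; apply: rV.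
  apply: le_ball (bw' x (exhausting_homo exL (leq_maxr n1 n2) n2x)).
  exact: ltW (n1r _ (leq_maxl n1 n2)).
by have [n _ nU] := Fw _ wU; exists n.
Qed.

Lemma ptws_box_nbhs (w : S -> E) (D : set S) (r : R) : 0 < r -> finite_set D ->
  nbhs (w : {ptws S -> E}) [set w' | forall x, D x -> ball (w x) r (w' x)].
Proof.
move=> r0 /(@finite_seqP {classic S})[s ->].
have FF := @nbhs_filter {ptws S -> E} w.
elim: s => [|x s IH].
  by apply: (@filterS _ _ FF _ _ _ (@filterT _ _ FF)) => w' _ x.
have xw : nbhs (w : {ptws S -> E}) [set w' | ball (w x) r (w' x)].
  exact: (@proj_continuous {classic S} (fun _ => E) x w _ (nbhsx_ballx _ _ r0)).
apply: (@filterS _ _ FF _ _ _ (@filterI _ _ FF _ _ xw IH)) => w' [bx bs] y /=.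
by rewrite in_cons => /predU1P[->//|]; exact: bs.
Qed.

(** A Heine-Cantor argument: the product is compact by Tychonoff, and a local estimate around each
    [w] becomes uniform by the near-covering form of compactness. *)
Lemma ptws_uniform_continuous (h : (S -> E) -> R) (r : R) :
  continuous (h : {ptws S -> E} -> R) -> 0 < r ->
  \forall n \near \oo, forall w w' : S -> E,
    (forall x, Lam n x -> ball (w x) (e n) (w' x)) -> `|h w - h w'| <= r.
Proof.
move=> ch r0.
have cT : compact [set: {ptws S -> E}].
  have := @tychonoff {classic S} (fun _ => E) (fun _ => setT) (fun _ => cE).
  by congr compact; apply/seteqP; split.
pose P n (w : {ptws S -> E}) := forall w' : S -> E,
  (forall x, Lam n x -> ball (w x) (e n) (w' x)) -> `|h w - h w'| <= r.
have locP (w : {ptws S -> E}) : [set: {ptws S -> E}] w ->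
    \forall w1 \near w & n \near \oo, P n w1.
  move=> _.
  have r20 : 0 < r / 2 by rewrite divr_gt0.
  have [n0 n0P] : exists n, forall w',
      (forall x, Lam n x -> ball (w x) (e n) (w' x)) -> `|h w - h w'| <= r / 2.
    apply: ptws_box_basis.
    exact: ((@cvgrPdist_le _ _ _ _ (@nbhs_filter {ptws S -> E} w) h _).1 (ch w)).
  have box : nbhs (w : {ptws S -> E})
      [set w1 | forall x, Lam n0 x -> ball (w x) (e n0 / 2) (w1 x)].
    apply: ptws_box_nbhs; first by rewrite divr_gt0// invr_gt0.
    by case: exL => /(_ n0)[].
  (* The bound [2 * n0 + 1 <= n] gives [e n <= e n0 / 2], so [w2] stays in the box of radius [e n0]
     around [w]. *)
  exists ([set w1 | forall x, Lam n0 x -> ball (w x) (e n0 / 2) (w1 x)],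
    [set n | (n0.*2.+1 <= n)%N]); first by split=> //; exists n0.*2.+1.
  move=> [w1 n] [/= w1P nP] w2 w2P.
  have n0n : (n0 <= n)%N by apply: leq_trans nP; rewrite -addnn -addnS leq_addr.
  have w1U : `|h w - h w1| <= r / 2.
    apply: n0P => x Lx; apply: le_ball (w1P _ Lx).
    by rewrite ler_pdivrMr// ler_peMr ?ler1n// invr_ge0.
  have w2U : `|h w - h w2| <= r / 2.
    apply: n0P => x Lx; rewrite [e n0]splitr.
    apply: ball_triangle (w1P _ Lx) _.
    apply: le_ball (w2P _ (exhausting_homo exL n0n Lx)).
    rewrite /e -invfM lef_pV2 ?posrE ?mulr_gt0//.
    by rewrite -natrM ler_nat muln2 doubleS ltnS.
  rewrite (_ : h w1 - h w2 = (h w - h w2) - (h w - h w1)); last by lra.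
  by rewrite (le_trans (ler_normB _ _))// [r]splitr lerD.
have [n0 _ n0P] := (compact_near_coveringP _).1 cT nat \oo P _ locP.
by exists n0 => // n /n0P nP w w'; exact: nP.
Qed.

(** The one-site code is applied at each of the finitely many sites of [Lam n]; a cell is a finite
    intersection of coordinate events. *)
Lemma configuration_cells n : exists (I : finType) (code : (S -> E) -> I),
  (forall i, measurable (code @^-1` [set i] : set (OmU (borelType E) (Lam n)))) /\
  (forall w w' : S -> E, code w = code w' ->
     forall x, Lam n x -> ball (w x) (e n) (w' x)).
Proof.
have [m [c [mc cb]]] : exists (m : nat) (c : borelType E -> 'I_m),
    (forall i, measurable (c @^-1` [set i])) /\
    (forall x y : E, c x = c y -> ball x (e n) y).
  by apply: compact_measurable_cells; rewrite invr_gt0.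
have [s Ls] : exists s : seq {classic S}, Lam n = [set` s].
  by apply/finite_seqP; case: exL => /(_ n)[].
pose f (i : 'I_(size s)) : S := tnth (in_tuple s) i.
exists {ffun 'I_(size s) -> 'I_m}, (fun w => [ffun i => c (w (f i))]); split.
  move=> t.
  have -> : (fun w : S -> E => [ffun i => c (w (f i))]) @^-1` [set t] =
      \bigcap_(i in [set: 'I_(size s)])
        [set w : S -> E | (c @^-1` [set t i]) (w (f i))].
    apply/seteqP; split=> w /=; first by move=> <- i _ /=; rewrite ffunE.
    by move=> wt; apply/ffunP => i; rewrite ffunE; exact: wt.
  apply: (@fin_bigcap_measurable _ (OmU (borelType E) (Lam n))).
    exact: finite_finset.
  move=> i _; apply: sub_sigma_algebra; exists (f i); split.
    by rewrite Ls /f /= mem_tnth.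
  by exists (c @^-1` [set t i]).
move=> w w' /ffunP ww' x; rewrite Ls => /(tnthP (in_tuple s))[i ->].
by have := ww' i; rewrite !ffunE => /cb.
Qed.

Lemma kernel_cvg_continuous_local (gamma : kernel_family le (borelType E) R)
    (mu : probability (Om S (borelType E)) R) : (forall x, le x x) ->
  is_POS gamma -> extremal_G gamma mu ->
  exists A : set (Om S (borelType E)),
    [/\ measurable A, mu A = 1%E &
    forall w, A w ->
      forall h : (S -> borelType E) -> R,
        continuous (h : {ptws S -> E} -> R) -> local_fun h ->
        (fun n => (\int[gamma (Lam n) w]_x (h x)%:E)%E) @ \oo
          --> (\int[mu]_x (h x)%:E)%E].
Proof.
move=> le_refl [proper _] extr.
pose I n := sval (cid (configuration_cells n)).
pose code n := sval (cid (svalP (cid (configuration_cells n)))).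
have codeP n : (forall i,
     measurable (code n @^-1` [set i] : set (OmU (borelType E) (Lam n)))) /\
  (forall w w' : S -> E, code n w = code n w' ->
     forall x, Lam n x -> ball (w x) (e n) (w' x)).
  exact: svalP (cid (svalP (cid (configuration_cells n)))).
have finL n : finite_set (Lam n) by case: exL => /(_ n)[].
have ae : {ae mu, forall w : Om S (borelType E), forall k i,
    gamma (Lam n) w (code k @^-1` [set i]) @[n --> \oo] -->
    mu (code k @^-1` [set i])}.
  apply: ae_foralln => k; apply: filter_forall => i.
  apply: (kernel_cvg_local_set le_refl proper extr exL (finL k)).
  exact: (codeP k).1.
(* The exceptional set depends only on the countably many cells, hence is fixed before [h] is
   chosen. *)
have [N [mN N0 subN]] := ae.
exists (~` N); split; first exact: measurableC.
  by rewrite probability_setC// N0 sube0.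
move=> w Nw h ch lh.
have cw : forall k i, gamma (Lam n) w (code k @^-1` [set i]) @[n --> \oo] -->
    mu (code k @^-1` [set i]).
  by apply: contrapT => /subN.
apply: kernel_cvg_cells => // r r0.
have [k _ kr] := ptws_uniform_continuous ch r0.
(* A representative of each cell. The default on an empty cell is harmless, since the error bound
   only involves [i = code k x]. *)
pose rep i := xget (fun=> point) [set x | code k x = i].
exists (I k), (code k), (fun i => h (rep i)), (Lam k); split.
- exact: finL.
- exact: (codeP k).1.
- move=> x; apply: (kr k (leqnn k)); apply: (codeP k).2.
  by rewrite /rep; case: xgetP => [y _ <-//|/(_ x)]; case.
- exact: cw.
Qed.

End CompactStateSpace.

Theorem mainTheorem6 (R : realType) (S : Type) (le : S -> S -> Prop) :
  standing_assumptions le ->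
  (* (i): general measurable space E *)
  (forall (d : measure_display) (E : measurableType d)
          (gamma : kernel_family le E R) (mu : probability (Om S E) R)
          (Lam : nat -> set S),
     is_POS gamma -> extremal_G gamma mu -> exhausting_time_boxes le Lam ->
     forall h : (S -> E) -> R, bounded_fun_ h -> local_fun h ->
       {ae mu, forall w : Om S E,
          (fun n => (\int[gamma (Lam n) w]_x (h x)%:E)%E) @ \oo
            --> (\int[mu]_x (h x)%:E)%E}) /\
  (* (ii): E a compact metric space with its Borel sigma-algebra *)
  (forall (E : pseudoPMetricType R), compact [set: E] -> hausdorff_space E ->
   forall (gamma : kernel_family le (borelType E) R)
          (mu : probability (Om S (borelType E)) R) (Lam : nat -> set S),
     is_POS gamma -> extremal_G gamma mu -> exhausting_time_boxes le Lam ->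
     exists A : set (Om S (borelType E)),
       [/\ measurable A, mu A = 1%E &
       forall w, A w ->
         forall h : (S -> borelType E) -> R,
           continuous (h : {ptws S -> E} -> R) -> local_fun h ->
           (fun n => (\int[gamma (Lam n) w]_x (h x)%:E)%E) @ \oo
             --> (\int[mu]_x (h x)%:E)%E]).
Proof.
move=> [_ [[le_refl _] _ _ _ _]]; split.
  move=> d E gamma mu Lam posg extr exL h bh lh.
  exact: kernel_cvg_bounded_local.
move=> E cE _ gamma mu Lam posg extr exL.
exact: kernel_cvg_continuous_local.
Qed.
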